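(* Let $n\ge1$ and let $\Omega\subset\mathbb{C}^n$ be a convex domain that is Kobayashi hyperbolic. Then $\Omega$ is holomorphic homogeneous regular, i.e. $\hat\sigma_\Omega=\inf_{p\in\Omega}\sigma_\Omega(p)>0$.
   Context: For $q\in\mathbb{C}^n$ and $r>0$ let $\mathbb{B}^n(q;r)=\{z\in\mathbb{C}^n:\|z-q\|<r\}$ (Euclidean norm) and $\mathbb{B}^n=\mathbb{B}^n(0;1)$. For a complex manifold $\Omega$ of dimension $n$ and $p\in\Omega$, let $\mathcal{F}(p,\Omega)$ be the set of injective holomorphic maps $f:\Omega\to\mathbb{B}^n$ with $f(p)=0$. The squeezing function is $\sigma_\Omega(p)=\sup\{r>0:\ \mathbb{B}^n(0;r)\subset f(\Omega)\text{ for some }f\in\mathcal{F}(p,\Omega)\}$, and the squeezing constant is $\hat\sigma_\Omega=\inf_{p\in\Omega}\sigma_\Omega(p)$. $\Omega$ is called holomorphic homogeneous regular (HHR), equivalently uniformly squeezing, if $\hat\sigma_\Omega>0$. *)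

(* Defs.v *)
From Stdlib Require Import Reals.
Open Scope R_scope.

Definition C : Type := (R * R)%type.
Definition C0 : C := (0, 0).
Definition C1 : C := (1, 0).
Definition Cadd (a b : C) : C := (fst a + fst b, snd a + snd b).
Definition Csub (a b : C) : C := (fst a - fst b, snd a - snd b).
Definition Cmul (a b : C) : C :=
  (fst a * fst b - snd a * snd b, fst a * snd b + snd a * fst b).
Definition Cconj (a : C) : C := (fst a, - snd a).
Definition Cnorm2 (a : C) : R := fst a * fst a + snd a * snd a.
Definition Cabs (a : C) : R := sqrt (Cnorm2 a).
Definition Crscale (t : R) (a : C) : C := (t * fst a, t * snd a).

Fixpoint rsum (n : nat) (f : nat -> R) : R :=
  match n with O => 0 | S k => rsum k f + f k end.
Fixpoint csum (n : nat) (f : nat -> C) : C :=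
  match n with O => C0 | S k => Cadd (csum k f) (f k) end.

(* A point of C^n is a sequence  v : nat -> C  with  v i = 0  for i >= n. *)
Definition Cvec : Type := nat -> C.
Definition is_vec (n : nat) (v : Cvec) : Prop := forall i, (n <= i)%nat -> v i = C0.
Definition vzero : Cvec := fun _ => C0.
Definition vadd (u v : Cvec) : Cvec := fun i => Cadd (u i) (v i).
Definition vsub (u v : Cvec) : Cvec := fun i => Csub (u i) (v i).
Definition vrscale (t : R) (v : Cvec) : Cvec := fun i => Crscale t (v i).
Definition vnorm (n : nat) (v : Cvec) : R := sqrt (rsum n (fun i => Cnorm2 (v i))).
Definition cmatvec (n : nat) (A : nat -> nat -> C) (h : Cvec) : Cvec :=
  fun i => csum n (fun j => Cmul (A i j) (h j)).

Definition cset : Type := Cvec -> Prop.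
Definition subset_Cn (n : nat) (Om : cset) : Prop := forall z, Om z -> is_vec n z.

Definition ball (n : nat) (q : Cvec) (r : R) : cset :=
  fun z => is_vec n z /\ vnorm n (vsub z q) < r.

Definition open_Cn (n : nat) (U : cset) : Prop :=
  subset_Cn n U /\
  forall z, U z -> exists eps, 0 < eps /\ forall w, ball n z eps w -> U w.

Definition connected_Cn (n : nat) (Om : cset) : Prop :=
  forall U V : cset, open_Cn n U -> open_Cn n V ->
    (forall z, Om z -> U z \/ V z) ->
    (exists z, Om z /\ U z) -> (exists z, Om z /\ V z) ->
    exists z, Om z /\ U z /\ V z.

Definition domain_Cn (n : nat) (Om : cset) : Prop :=
  open_Cn n Om /\ connected_Cn n Om /\ exists z, Om z.

Definition convex_Cn (n : nat) (Om : cset) : Prop :=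
  forall x y t, Om x -> Om y -> 0 <= t <= 1 ->
    Om (vadd (vrscale (1 - t) x) (vrscale t y)).

Definition holomorphic (n m : nat) (U : cset) (f : Cvec -> Cvec) : Prop :=
  (forall z, U z -> is_vec m (f z)) /\
  forall z, U z ->
    exists A : nat -> nat -> C,
      forall eps, 0 < eps -> exists delta, 0 < delta /\
        forall w, U w -> vnorm n (vsub w z) < delta ->
          vnorm m (vsub (vsub (f w) (f z)) (cmatvec n A (vsub w z)))
            <= eps * vnorm n (vsub w z).

Definition disc : cset := ball 1 vzero 1.

(* Poincare distance on the unit disc: tanh^{-1} | (a-b)/(1 - conj(a) b) | *)
Definition poincare (a b : C) : R :=
  let t := Cabs (Csub a b) / Cabs (Csub C1 (Cmul (Cconj a) b)) in
  / 2 * ln ((1 + t) / (1 - t)).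

Definition kob_chain (n : nat) (Om : cset) (p q : Cvec) (m : nat)
  (phi : nat -> Cvec -> Cvec) (a b : nat -> Cvec) : Prop :=
  (1 <= m)%nat /\
  (forall j, (j < m)%nat ->
     holomorphic 1 n disc (phi j) /\ (forall z, disc z -> Om (phi j z)) /\
     disc (a j) /\ disc (b j)) /\
  phi O (a O) = p /\
  (forall j, (Datatypes.S j < m)%nat -> phi j (b j) = phi (Datatypes.S j) (a (Datatypes.S j))) /\
  phi (pred m) (b (pred m)) = q.

Definition kob_chain_length (m : nat) (a b : nat -> Cvec) : R :=
  rsum m (fun j => poincare (a j O) (b j O)).

(* "k_S(p,q) >= c" for the Kobayashi pseudodistance k_S (an infimum over
   chains), written out *)
Definition kob_dist_ge (n : nat) (Om : cset) (p q : Cvec) (c : R) : Prop :=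
  forall m phi a b, kob_chain n Om p q m phi a b -> c <= kob_chain_length m a b.

Definition kobayashi_hyperbolic (n : nat) (Om : cset) : Prop :=
  forall p q, Om p -> Om q -> p <> q ->
    exists c, 0 < c /\ kob_dist_ge n Om p q c.

Definition squeeze_maps (n : nat) (Om : cset) (p : Cvec) (f : Cvec -> Cvec) : Prop :=
  holomorphic n n Om f /\
  (forall z, Om z -> ball n vzero 1 (f z)) /\
  (forall z w, Om z -> Om w -> f z = f w -> z = w) /\
  f p = vzero.

(* "sigma_S(p) >= c": the set {r > 0 : B(0;r) subset f(S), f in F(p,S)}
   (downward closed) has supremum >= c, i.e. contains every r in (0,c). *)
Definition squeezing_ge (n : nat) (Om : cset) (p : Cvec) (c : R) : Prop :=
  forall r, 0 < r < c ->
    exists f, squeeze_maps n Om p f /\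
      forall w, ball n vzero r w -> exists z, Om z /\ f z = w.

Definition HHR (n : nat) (Om : cset) : Prop :=
  exists c, 0 < c /\ forall p, Om p -> squeezing_ge n Om p c.

(* Main.v *)
(** Fix [x] in [Omega] and let [p] be the gauge of [Omega - x].  Hyperbolicity excludes complex lines
    (a disc of large radius inside a line gives short Kobayashi chains), so [p] does not vanish on all
    rotations of a nonzero vector.  A triangular choice of complex linear forms [l_1, ..., l_n] with
    [Re l_j <= p], i.e. of supporting half spaces of [Omega] at [x], gives coordinates in which
    [Omega - x] lies in the product of the half planes [Re < 2] and contains a polydisc whose radius
    depends on [n] only.  Cayley transforms in each coordinate, divided by [n], then map [Omega] into the
    unit ball and [x] to 0, with an image that contains a ball of radius independent of [x]. *)

From Stdlib Require Import Reals Lra Lia Field List Classical FunctionalExtensionality.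
Require Import Defs.
Open Scope R_scope.

(** * Complex numbers *)

Definition Copp (a : C) : C := (- fst a, - snd a).
Definition Cinv (a : C) : C := Crscale (/ Cnorm2 a) (Cconj a).
Definition Cdiv (a b : C) : C := Cmul a (Cinv b).

Lemma C_ext (a b : C) : fst a = fst b -> snd a = snd b -> a = b.
Proof. destruct a, b; simpl; intros -> ->; reflexivity. Qed.

Ltac cring := intros; apply C_ext; unfold Cnorm2, C0, C1; simpl; ring.

Lemma Cnorm2_pos (a : C) : a <> C0 -> 0 < Cnorm2 a.
Proof.
  destruct a as [x y]; unfold Cnorm2, C0; simpl; intros H.
  destruct (Req_dec x 0) as [-> | Hx]; [destruct (Req_dec y 0) as [-> | Hy]|]; [easy | nra | nra].
Qed.

Lemma C_field : field_theory C0 C1 Cadd Cmul Csub Copp Cdiv Cinv eq.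
Proof.
  constructor.
  - constructor; cring.
  - unfold C0, C1; intros H; injection H; lra.
  - reflexivity.
  - intros a Ha; pose proof (Cnorm2_pos a Ha) as H; unfold Cnorm2 in H.
    unfold Cinv, Crscale, Cmul, Cconj, C1, Cnorm2; simpl.
    apply (f_equal2 pair); field; lra.
Qed.

Add Field C_field : C_field.

Lemma Cabs_pos (a : C) : 0 <= Cabs a.
Proof. apply sqrt_pos. Qed.

Lemma Cabs_sqr (a : C) : Cabs a * Cabs a = Cnorm2 a.
Proof. apply sqrt_sqrt; unfold Cnorm2; nra. Qed.

Lemma Cabs_mul (a b : C) : Cabs (Cmul a b) = Cabs a * Cabs b.
Proof.
  unfold Cabs; rewrite <- sqrt_mult by (unfold Cnorm2; nra).
  f_equal; unfold Cnorm2, Cmul; simpl; ring.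
Qed.

Lemma Cabs_le_sum (a : C) : Cabs a <= Rabs (fst a) + Rabs (snd a).
Proof.
  pose proof (Cabs_sqr a) as H; unfold Cnorm2 in H.
  pose proof (Rabs_pos (fst a)); pose proof (Rabs_pos (snd a)).
  pose proof (Rsqr_abs (fst a)) as Hx; pose proof (Rsqr_abs (snd a)) as Hy.
  unfold Rsqr in *; pose proof (Cabs_pos a); nra.
Qed.

Lemma Rabs_fst_le (a : C) : Rabs (fst a) <= Cabs a.
Proof.
  pose proof (Cabs_sqr a) as H; unfold Cnorm2 in H; pose proof (Cabs_pos a).
  apply Rabs_le; nra.
Qed.

Lemma Rabs_snd_le (a : C) : Rabs (snd a) <= Cabs a.
Proof.
  pose proof (Cabs_sqr a) as H; unfold Cnorm2 in H; pose proof (Cabs_pos a).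
  apply Rabs_le; nra.
Qed.

Lemma Cabs_add (a b : C) : Cabs (Cadd a b) <= Cabs a + Cabs b.
Proof.
  pose proof (Cabs_sqr a) as Ha; pose proof (Cabs_sqr b) as Hb;
    pose proof (Cabs_sqr (Cadd a b)) as Hab.
  pose proof (Cabs_pos a); pose proof (Cabs_pos b); pose proof (Cabs_pos (Cadd a b)).
  (* Cauchy-Schwarz for the cross term of [|a + b|^2]: the real part of [conj(a) b] is at most
     [|a| |b|]. *)
  pose proof (Rabs_fst_le (Cmul (Cconj a) b)) as H2.
  rewrite Cabs_mul in H2.
  assert (Cabs (Cconj a) = Cabs a) as E by (unfold Cabs; f_equal; unfold Cnorm2, Cconj; simpl; ring).
  rewrite E in H2; pose proof (Rle_abs (fst (Cmul (Cconj a) b))).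
  unfold Cnorm2, Cmul, Cconj, Cadd in *; simpl in *; nra.
Qed.

Lemma Cabs_unit (x y : R) : x * x + y * y = 1 -> Cabs (x, y) = 1.
Proof. intros H; unfold Cabs, Cnorm2; simpl; rewrite H; apply sqrt_1. Qed.

Lemma Cabs_C0 : Cabs C0 = 0.
Proof. unfold Cabs, Cnorm2, C0; simpl; rewrite Rmult_0_l, Rplus_0_l; apply sqrt_0. Qed.

Lemma Cabs_pos_neq0 (a : C) : 0 < Cabs a -> a <> C0.
Proof. intros H ->; rewrite Cabs_C0 in H; lra. Qed.

Lemma Cabs_div (a b : C) : b <> C0 -> Cabs (Cdiv a b) * Cabs b = Cabs a.
Proof. intros Hb; rewrite <- Cabs_mul; f_equal; field; exact Hb. Qed.

Lemma Cabs_opp (a : C) : Cabs (Copp a) = Cabs a.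
Proof. unfold Cabs; f_equal; unfold Cnorm2, Copp; simpl; ring. Qed.

Lemma Cabs_sub (a b : C) : Cabs (Csub a b) <= Cabs a + Cabs b.
Proof.
  rewrite <- (Cabs_opp b); replace (Csub a b) with (Cadd a (Copp b)) by ring; apply Cabs_add.
Qed.

Lemma finite_bound (f : nat -> R) (k : nat) :
  exists d, 0 <= d /\ forall j, (j < k)%nat -> f j <= d.
Proof.
  induction k as [|k [d [Hd H]]].
  - exists 0; split; [lra|intros; lia].
  - exists (d + Rabs (f k)); pose proof (Rabs_pos (f k)); split; [lra|].
    intros j Hj; destruct (Nat.eq_dec j k) as [->|]; [pose proof (Rle_abs (f k)); lra|].
    specialize (H j ltac:(lia)); lra.
Qed.

Definition vcscale (c : C) (v : Cvec) : Cvec := fun i => Cmul c (v i).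

Ltac vring :=
  intros; apply functional_extensionality; intros ?; apply C_ext; simpl;
  first [ring | field; lra].

(** * Sublinear functionals and support functionals *)

Definition sublinear (q : Cvec -> R) : Prop :=
  (forall u v, q (vadd u v) <= q u + q v) /\
  (forall t v, 0 <= t -> q (vrscale t v) = t * q v).

(** The reverse homogeneity inequality comes from applying the given one to [/ t] and
    [vrscale t v]. *)
Lemma sublinear_intro (q : Cvec -> R) :
  q vzero = 0 ->
  (forall u v, q (vadd u v) <= q u + q v) ->
  (forall t v, 0 < t -> q (vrscale t v) <= t * q v) ->
  sublinear q.
Proof.
  intros H0 Hadd Hs; split; [exact Hadd|]; intros t v [Ht | <-].
  - apply Rle_antisym; [auto|].
    pose proof (Hs (/ t) (vrscale t v) (Rinv_0_lt_compat _ Ht)) as H.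
    replace (vrscale (/ t) (vrscale t v)) with v in H by vring.
    apply (Rmult_le_compat_l t) in H; [|lra].
    rewrite <- Rmult_assoc, Rinv_r, Rmult_1_l in H; lra.
  - replace (vrscale 0 v) with vzero by vring; lra.
Qed.

Lemma sublinear_zero (q : Cvec -> R) : sublinear q -> q vzero = 0.
Proof.
  intros [_ H]; replace vzero with (vrscale 0 vzero) by vring.
  rewrite H; lra.
Qed.

Lemma sublinear_neg (q : Cvec -> R) (v : Cvec) :
  sublinear q -> 0 <= q v + q (vrscale (-1) v).
Proof.
  intros H; rewrite <- (sublinear_zero q H); destruct H as [H _].
  replace vzero with (vadd v (vrscale (-1) v)) by vring; apply H.
Qed.

(** [completeness] returns its supremum as data, so the infima of all the sets [E a], taken through
    negation, form a function without a choice principle. *)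
Lemma infimum_function (A : Type) (E : A -> R -> Prop) :
  (forall a, exists x, E a x) ->
  (forall a, exists m, forall x, E a x -> m <= x) ->
  exists g : A -> R, forall a,
    (forall x, E a x -> g a <= x) /\
    (forall m, (forall x, E a x -> m <= x) -> m <= g a).
Proof.
  intros Hne Hb.
  assert (forall a, bound (fun x => E a (- x))) as B.
  { intros a; destruct (Hb a) as [m Hm]; exists (- m); intros x Hx; specialize (Hm _ Hx); lra. }
  assert (forall a, exists x, (fun x => E a (- x)) x) as Ne.
  { intros a; destruct (Hne a) as [x Hx]; exists (- x); rewrite Ropp_involutive; exact Hx. }
  exists (fun a => - proj1_sig (completeness _ (B a) (Ne a))); intros a.
  destruct (completeness _ (B a) (Ne a)) as [s [Hs1 Hs2]]; simpl; split.
  - intros x Hx; assert (- x <= s); [|lra].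
    apply Hs1; rewrite Ropp_involutive; exact Hx.
  - intros m Hm; assert (s <= - m); [|lra].
    apply Hs2; intros x Hx; specialize (Hm _ Hx); lra.
Qed.

(** [p] is the Minkowski functional, the infimum of the [t > 0] with [v] in [t D]. The infimum need
    not be attained, so [D] is only caught between [p < 1] and [p <= 1]. *)
Lemma gauge (n : nat) (D : cset) :
  convex_Cn n D ->
  (forall v, exists t, 0 < t /\ D (vrscale (/ t) v)) ->
  exists p, sublinear p /\ (forall v, 0 <= p v) /\
    (forall v, p v < 1 -> D v) /\ (forall v, D v -> p v <= 1).
Proof.
  intros Hc Ha.
  assert (D vzero) as D0.
  { destruct (Ha vzero) as [t [_ H]]; replace (vrscale (/ t) vzero) with vzero in H by vring; exact H. }
  destruct (infimum_function Cvec (fun v t => 0 < t /\ exists u, D u /\ v = vrscale t u)) as [p Hp].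
  - intros v; destruct (Ha v) as [t [Ht H]]; exists t; split; [exact Ht|].
    exists (vrscale (/ t) v); split; [exact H | vring].
  - intros v; exists 0; intros x [Hx _]; lra.
  - exists p.
    assert (forall v, 0 <= p v) as Hpos.
    { intros v; apply (proj2 (Hp v)); intros x [Hx _]; lra. }
    split; [apply sublinear_intro|split; [exact Hpos|split]].
    + apply Rle_antisym; [|apply Hpos]; apply le_epsilon; intros e He; rewrite Rplus_0_l.
      apply (proj1 (Hp _)); split; [exact He|exists vzero; split; [exact D0|vring]].
    + intros u v.
      assert (p (vadd u v) - p v <= p u); [|lra].
      apply (proj2 (Hp u)); intros s [Hs [u' [Du ->]]].
      assert (p (vadd (vrscale s u') v) - s <= p v); [|lra].
      apply (proj2 (Hp v)); intros t [Ht [v' [Dv ->]]].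
      assert (p (vadd (vrscale s u') (vrscale t v')) <= s + t); [|lra].
      apply (proj1 (Hp _)); split; [lra|].
      (* Dilated by [s + t], this convex combination becomes [s u' + t v']. *)
      exists (vadd (vrscale (1 - t / (s + t)) u') (vrscale (t / (s + t)) v')); split.
      * apply Hc; [exact Du|exact Dv|split].
        { apply Rlt_le, Rdiv_lt_0_compat; lra. }
        { apply (Rmult_le_reg_r (s + t)); [lra|]; field_simplify; lra. }
      * vring.
    + intros t v Ht.
      assert (p (vrscale t v) / t <= p v) as H.
      { apply (proj2 (Hp v)); intros s [Hs [u [Du ->]]].
        apply (Rmult_le_reg_r t); [exact Ht|].
        unfold Rdiv; rewrite Rmult_assoc, Rinv_l, Rmult_1_r by lra.
        apply (proj1 (Hp _)); split; [nra|]; exists u; split; [exact Du|vring]. }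
      apply (Rmult_le_compat_l t) in H; [|lra].
      replace (t * (p (vrscale t v) / t)) with (p (vrscale t v)) in H by (field; lra); exact H.
    (* A multiple [t u] with [u] in [D] and [t < 1] lies on the segment from 0 to [u], hence in [D];
       so for [v] outside [D] every admissible [t] is at least 1. *)
    + intros v Hv; apply NNPP; intros Hn.
      assert (1 <= p v); [|lra].
      apply (proj2 (Hp v)); intros t [Ht [u [Du ->]]].
      apply Rnot_lt_le; intros Ht1; apply Hn.
      replace (vrscale t u) with (vadd (vrscale (1 - t) vzero) (vrscale t u)) by vring.
      apply Hc; [exact D0|exact Du|lra].
    + intros v Dv; apply (proj1 (Hp v)); split; [lra|]; exists v; split; [exact Dv|vring].
Qed.

(* The tightening is [q' v = inf_{t >= 0} (q (v + t y) - t q y)]; the inequality at [-y] comes from [t = 1]. *)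
Lemma tighten (q : Cvec -> R) (y : Cvec) :
  sublinear q ->
  exists q', sublinear q' /\ (forall v, q' v <= q v) /\ q' (vrscale (-1) y) <= - q y.
Proof.
  intros Hq; pose proof (sublinear_zero q Hq) as H0; destruct Hq as [Hadd Hs].
  destruct (infimum_function Cvec
    (fun v x => exists t, 0 <= t /\ x = q (vadd v (vrscale t y)) - t * q y)) as [g Hg].
  - intros v; eexists; exists 0; split; [lra|reflexivity].
  (* Finiteness of the infimum: [t q y = q (t y) <= q (v + t y) + q (- v)]. *)
  - intros v; exists (- q (vrscale (-1) v)); intros x [t [Ht ->]].
    pose proof (Hadd (vadd v (vrscale t y)) (vrscale (-1) v)) as H.
    replace (vadd (vadd v (vrscale t y)) (vrscale (-1) v)) with (vrscale t y) in H by vring.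
    rewrite Hs in H by exact Ht; lra.
  - assert (forall v, g v <= q v) as Hle.
    { intros v; apply (proj1 (Hg v)); exists 0; split; [lra|].
      replace (vadd v (vrscale 0 y)) with v by vring; lra. }
    exists g; split; [apply sublinear_intro|split; [exact Hle|]].
    + apply Rle_antisym; [rewrite <- H0; apply Hle|].
      apply (proj2 (Hg _)); intros x [t [Ht ->]].
      replace (vadd vzero (vrscale t y)) with (vrscale t y) by vring.
      rewrite Hs by exact Ht; lra.
    + intros u v.
      assert (g (vadd u v) - g v <= g u); [|lra].
      apply (proj2 (Hg u)); intros a [s [Hs' ->]].
      assert (g (vadd u v) - (q (vadd u (vrscale s y)) - s * q y) <= g v); [|lra].
      apply (proj2 (Hg v)); intros b [t [Ht ->]].
      assert (g (vadd u v) <= q (vadd (vadd u v) (vrscale (s + t) y)) - (s + t) * q y) as H1.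
      { apply (proj1 (Hg _)); exists (s + t); split; [lra|reflexivity]. }
      pose proof (Hadd (vadd u (vrscale s y)) (vadd v (vrscale t y))) as H2.
      replace (vadd (vadd u (vrscale s y)) (vadd v (vrscale t y)))
        with (vadd (vadd u v) (vrscale (s + t) y)) in H2 by vring.
      lra.
    + intros t v Ht.
      assert (g (vrscale t v) / t <= g v) as H.
      { apply (proj2 (Hg v)); intros a [s [Hs' ->]].
        apply (Rmult_le_reg_r t); [exact Ht|].
        unfold Rdiv; rewrite Rmult_assoc, Rinv_l, Rmult_1_r by lra.
        apply (proj1 (Hg _)); exists (t * s); split; [nra|].
        replace (vadd (vrscale t v) (vrscale (t * s) y))
          with (vrscale t (vadd v (vrscale s y))) by vring.
        rewrite Hs by lra; ring. }
      apply (Rmult_le_compat_l t) in H; [|lra].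
      replace (t * (g (vrscale t v) / t)) with (g (vrscale t v)) in H by (field; lra); exact H.
    + apply (proj1 (Hg _)); exists 1; split; [lra|].
      replace (vadd (vrscale (-1) y) (vrscale 1 y)) with vzero by vring; lra.
Qed.

(** Symmetry along [y'], once reached, survives any sublinear [g <= q]:
    [g (- y') <= q (- y') = - q y' <= - g y'], and the reverse inequality is [sublinear_neg]. So the
    vectors can be treated one after the other. *)
Lemma tighten_list (ys : list Cvec) (p : Cvec -> R) :
  sublinear p ->
  exists q, sublinear q /\ (forall v, q v <= p v) /\
    forall y, In y ys -> q (vrscale (-1) y) = - q y.
Proof.
  intros Hp; induction ys as [|y ys IH].
  - exists p; split; [exact Hp|split; [intros; lra|intros y []]].
  - destruct IH as [q [Hq [Hle Hy]]].
    destruct (tighten q y Hq) as [g [Hg [Hgq Hgy]]].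
    exists g; split; [exact Hg|split].
    + intros v; specialize (Hle v); specialize (Hgq v); lra.
    + intros y' Hy'; pose proof (sublinear_neg g y' Hg).
      pose proof (Hgq y'); pose proof (Hgq (vrscale (-1) y')).
      destruct Hy' as [<-|Hy']; [|specialize (Hy _ Hy')]; lra.
Qed.

(** Symmetry makes [q] linear on the real line through [y]; subadditivity is then used once to add
    [t y] and once to remove it. *)
Lemma sublinear_add_sym (q : Cvec -> R) (u y : Cvec) (t : R) :
  sublinear q -> q (vrscale (-1) y) = - q y ->
  q (vadd u (vrscale t y)) = q u + t * q y.
Proof.
  intros [Hadd Hs] Hy.
  assert (forall s, q (vrscale s y) = s * q y) as H.
  { intros s; destruct (Rle_dec 0 s) as [Hs0|Hs0]; [auto|].
    replace (vrscale s y) with (vrscale (- s) (vrscale (-1) y)) by vring.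
    rewrite Hs, Hy by lra; ring. }
  apply Rle_antisym.
  - rewrite <- H; apply Hadd.
  - pose proof (Hadd (vadd u (vrscale t y)) (vrscale (- t) y)) as H1.
    replace (vadd (vadd u (vrscale t y)) (vrscale (- t) y)) with u in H1 by vring.
    rewrite H in H1; lra.
Qed.

(** * Coordinates and complex linear forms *)

Definition trunc (k : nat) (z : Cvec) : Cvec := fun i => if Nat.ltb i k then z i else C0.
Definition basis (k : nat) (c : C) : Cvec := fun i => if Nat.eqb i k then c else C0.

Lemma trunc_is_vec (k : nat) (z : Cvec) : is_vec k (trunc k z).
Proof. intros i Hi; unfold trunc; destruct (Nat.ltb_spec i k); [lia|reflexivity]. Qed.

Lemma trunc_id (k : nat) (z : Cvec) : is_vec k z -> trunc k z = z.
Proof.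
  intros H; apply functional_extensionality; intros i; unfold trunc.
  destruct (Nat.ltb_spec i k); [reflexivity|symmetry; auto].
Qed.

Definition lin (n : nat) (a : nat -> C) (z : Cvec) : C := csum n (fun j => Cmul (a j) (z j)).

(** Finite-dimensional Hahn-Banach: tightening at [y] first fixes the value there, and tightening
    along the [2n] real basis vectors then makes the functional real linear on C^n. *)
Lemma support_functional (n : nat) (p : Cvec -> R) (y : Cvec) :
  sublinear p -> is_vec n y ->
  exists a, (forall z, is_vec n z -> fst (lin n a z) <= p z) /\ fst (lin n a y) = p y.
Proof.
  intros Hp Hy.
  destruct (tighten p y Hp) as [p1 [Hp1 [Hle1 Hy1]]].
  destruct (tighten_list (map (fun j => basis j C1) (seq 0 n) ++
                          map (fun j => basis j (0, 1)) (seq 0 n)) p1 Hp1)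
    as [q [Hq [Hle2 Hsym]]].
  (* The complex form with real part [q] has coefficients [q(e_j) - i q(i e_j)]. *)
  exists (fun j => (q (basis j C1), - q (basis j (0, 1)))).
  assert (forall z k, (k <= n)%nat ->
    fst (lin k (fun j => (q (basis j C1), - q (basis j (0, 1)))) z) = q (trunc k z)) as Hlin.
  { intros z; induction k as [|k IH]; intros Hk.
    - replace (trunc 0 z) with vzero by reflexivity.
      rewrite (sublinear_zero q Hq); reflexivity.
    - assert (trunc (S k) z = vadd (vadd (trunc k z) (vrscale (fst (z k)) (basis k C1)))
                                   (vrscale (snd (z k)) (basis k (0, 1)))) as ->.
      { apply functional_extensionality; intros i; unfold trunc, vadd, vrscale, basis.
        destruct (Nat.eqb_spec i k) as [->|Hik].
        - rewrite Nat.ltb_irrefl; destruct (Nat.ltb_spec k (S k)); [|lia].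
          destruct (z k); cring.
        - destruct (Nat.ltb_spec i (S k)), (Nat.ltb_spec i k); try lia;
            [destruct (z i)|]; cring. }
      rewrite !sublinear_add_sym; [| assumption | | assumption |];
        [| apply Hsym, in_or_app; left; apply in_map_iff; exists k; split; [reflexivity|apply in_seq; lia]
         | apply Hsym, in_or_app; right; apply in_map_iff; exists k; split; [reflexivity|apply in_seq; lia]].
      rewrite <- IH by lia; unfold lin; simpl; ring. }
  assert (forall z, is_vec n z ->
    fst (lin n (fun j => (q (basis j C1), - q (basis j (0, 1)))) z) = q z) as E.
  { intros z Hz; rewrite Hlin, trunc_id by auto; reflexivity. }
  split.
  - intros z Hz; rewrite E by exact Hz; specialize (Hle1 z); specialize (Hle2 z); lra.
  (* From below: [q y >= - q (- y) >= - p1 (- y) >= p y]. *)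
  - rewrite E by exact Hy; pose proof (Hle1 y); pose proof (Hle2 y).
    pose proof (Hle2 (vrscale (-1) y)); pose proof (sublinear_neg q y Hq); lra.
Qed.

Lemma lin_add (n : nat) (a : nat -> C) (u v : Cvec) :
  lin n a (vadd u v) = Cadd (lin n a u) (lin n a v).
Proof. unfold lin; induction n as [|n IH]; simpl; [cring|rewrite IH; unfold vadd; ring]. Qed.

Lemma lin_cscale (n : nat) (a : nat -> C) (c : C) (v : Cvec) :
  lin n a (vcscale c v) = Cmul c (lin n a v).
Proof. unfold lin; induction n as [|n IH]; simpl; [cring|rewrite IH; unfold vcscale; ring]. Qed.

Lemma lin_sub (n : nat) (a : nat -> C) (u v : Cvec) :
  lin n a (vsub u v) = Csub (lin n a u) (lin n a v).
Proof. unfold lin; induction n as [|n IH]; simpl; [cring|rewrite IH; unfold vsub; ring]. Qed.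

Lemma is_vec_le (m n : nat) (v : Cvec) : (m <= n)%nat -> is_vec m v -> is_vec n v.
Proof. intros H Hv i Hi; apply Hv; lia. Qed.

Lemma is_vec_add (n : nat) (u v : Cvec) : is_vec n u -> is_vec n v -> is_vec n (vadd u v).
Proof. intros Hu Hv i Hi; unfold vadd; rewrite Hu, Hv by exact Hi; cring. Qed.

Lemma is_vec_sub (n : nat) (u v : Cvec) : is_vec n u -> is_vec n v -> is_vec n (vsub u v).
Proof. intros Hu Hv i Hi; unfold vsub; rewrite Hu, Hv by exact Hi; cring. Qed.

Lemma is_vec_cscale (n : nat) (c : C) (v : Cvec) : is_vec n v -> is_vec n (vcscale c v).
Proof. intros Hv i Hi; unfold vcscale; rewrite Hv by exact Hi; cring. Qed.

Lemma is_vec_basis (k : nat) (c : C) : is_vec (S k) (basis k c).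
Proof. intros i Hi; unfold basis; destruct (Nat.eqb_spec i k); [lia|reflexivity]. Qed.

(** * Triangular systems of support functionals *)

(* A stand-in for the complex seminorm [sup_{|c| = 1} p (c v)], comparable to it up to constants. *)
Definition circled (p : Cvec -> R) (v : Cvec) : R :=
  p v + p (vrscale (-1) v) + p (vcscale (0, 1) v) + p (vcscale (0, -1) v).

Section Frame.

Variable p : Cvec -> R.
Hypothesis Hp : sublinear p.
Hypothesis Hpos : forall v, 0 <= p v.

Lemma circled_pos (v : Cvec) : 0 <= circled p v.
Proof.
  unfold circled; pose proof (Hpos v); pose proof (Hpos (vrscale (-1) v)).
  pose proof (Hpos (vcscale (0, 1) v)); pose proof (Hpos (vcscale (0, -1) v)); lra.
Qed.

Lemma circled_ge (v : Cvec) : p v <= circled p v.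
Proof.
  unfold circled; pose proof (Hpos (vrscale (-1) v)).
  pose proof (Hpos (vcscale (0, 1) v)); pose proof (Hpos (vcscale (0, -1) v)); lra.
Qed.

Lemma gauge_rscale (t : R) (v : Cvec) :
  p (vrscale t v) <= Rabs t * (p v + p (vrscale (-1) v)).
Proof.
  destruct Hp as [_ Hs]; pose proof (Hpos v); pose proof (Hpos (vrscale (-1) v)).
  destruct (Rle_dec 0 t) as [Ht|Ht].
  - rewrite Hs, Rabs_pos_eq by exact Ht; nra.
  - replace (vrscale t v) with (vrscale (- t) (vrscale (-1) v)) by vring.
    rewrite Hs, Rabs_left by lra; nra.
Qed.

(** With [c v = Re c v + Im c (i v)], the two real multiples use disjoint pairs of summands of
    [circled], so the constant is 1. *)
Lemma gauge_cscale (c : C) (v : Cvec) : p (vcscale c v) <= Cabs c * circled p v.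
Proof.
  replace (vcscale c v) with (vadd (vrscale (fst c) v) (vrscale (snd c) (vcscale (0, 1) v))) by vring.
  eapply Rle_trans; [apply (proj1 Hp)|].
  pose proof (gauge_rscale (fst c) v) as H1.
  pose proof (gauge_rscale (snd c) (vcscale (0, 1) v)) as H2.
  replace (vrscale (-1) (vcscale (0, 1) v)) with (vcscale (0, -1) v) in H2 by vring.
  pose proof (Rabs_fst_le c); pose proof (Rabs_snd_le c).
  pose proof (Hpos v); pose proof (Hpos (vrscale (-1) v)).
  pose proof (Hpos (vcscale (0, 1) v)); pose proof (Hpos (vcscale (0, -1) v)).
  unfold circled; nra.
Qed.

Lemma circled_cscale (c : C) (v : Cvec) : circled p (vcscale c v) <= 4 * Cabs c * circled p v.
Proof.
  unfold circled at 1.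
  replace (vrscale (-1) (vcscale c v)) with (vcscale (Cmul (-1, 0) c) v) by vring.
  replace (vcscale (0, 1) (vcscale c v)) with (vcscale (Cmul (0, 1) c) v) by vring.
  replace (vcscale (0, -1) (vcscale c v)) with (vcscale (Cmul (0, -1) c) v) by vring.
  pose proof (gauge_cscale c v) as H1.
  pose proof (gauge_cscale (Cmul (-1, 0) c) v) as H2.
  pose proof (gauge_cscale (Cmul (0, 1) c) v) as H3.
  pose proof (gauge_cscale (Cmul (0, -1) c) v) as H4.
  rewrite Cabs_mul, Cabs_unit in H2, H3, H4 by ring.
  lra.
Qed.

Lemma circled_add (u v : Cvec) : circled p (vadd u v) <= circled p u + circled p v.
Proof.
  destruct Hp as [Hadd _]; unfold circled.
  replace (vrscale (-1) (vadd u v)) with (vadd (vrscale (-1) u) (vrscale (-1) v)) by vring.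
  replace (vcscale (0, 1) (vadd u v)) with (vadd (vcscale (0, 1) u) (vcscale (0, 1) v)) by vring.
  replace (vcscale (0, -1) (vadd u v)) with (vadd (vcscale (0, -1) u) (vcscale (0, -1) v)) by vring.
  pose proof (Hadd u v); pose proof (Hadd (vrscale (-1) u) (vrscale (-1) v)).
  pose proof (Hadd (vcscale (0, 1) u) (vcscale (0, 1) v)).
  pose proof (Hadd (vcscale (0, -1) u) (vcscale (0, -1) v)); lra.
Qed.

(** The largest of the four summands is at least their average. *)
Lemma circled_rotation (v : Cvec) :
  exists c, Cabs c = 1 /\ circled p v <= 4 * p (vcscale c v).
Proof.
  unfold circled.
  replace (p v) with (p (vcscale (1, 0) v)) by (f_equal; vring).
  replace (vrscale (-1) v) with (vcscale (-1, 0) v) by vring.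
  set (a1 := p (vcscale (1, 0) v)); set (a2 := p (vcscale (-1, 0) v)).
  set (a3 := p (vcscale (0, 1) v)); set (a4 := p (vcscale (0, -1) v)).
  destruct (Rle_dec (a1 + a2 + a3 + a4) (4 * a1)); [exists (1, 0); split; [apply Cabs_unit; ring|assumption]|].
  destruct (Rle_dec (a1 + a2 + a3 + a4) (4 * a2)); [exists (-1, 0); split; [apply Cabs_unit; ring|assumption]|].
  destruct (Rle_dec (a1 + a2 + a3 + a4) (4 * a3)); [exists (0, 1); split; [apply Cabs_unit; ring|assumption]|].
  exists (0, -1); split; [apply Cabs_unit; ring|fold a4; lra].
Qed.

(** The hypothesis at [z], [-z], [iz], [-iz] bounds the real and imaginary parts of the form with
    both signs, each by one summand of [circled]. *)
Lemma Cabs_lin_le (n : nat) (a : nat -> C) (z : Cvec) :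
  (forall v, is_vec n v -> fst (lin n a v) <= p v) -> is_vec n z ->
  Cabs (lin n a z) <= circled p z.
Proof.
  intros Ha Hz.
  pose proof (Ha z Hz) as H1.
  pose proof (Ha _ (is_vec_cscale n (-1, 0) z Hz)) as H2.
  pose proof (Ha _ (is_vec_cscale n (0, 1) z Hz)) as H3.
  pose proof (Ha _ (is_vec_cscale n (0, -1) z Hz)) as H4.
  rewrite lin_cscale in H2, H3, H4.
  replace (vcscale (-1, 0) z) with (vrscale (-1) z) in H2 by vring.
  pose proof (Hpos z); pose proof (Hpos (vrscale (-1) z)).
  pose proof (Hpos (vcscale (0, 1) z)); pose proof (Hpos (vcscale (0, -1) z)).
  eapply Rle_trans; [apply Cabs_le_sum|].
  unfold circled; simpl in *; unfold Rabs; repeat destruct Rcase_abs; lra.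
Qed.

(* Gram-Schmidt without inner product: the new functional [a] is a support functional of the gauge at a
   (rotated) vector [v] of C^(k+1) on which the previous ones vanish, so that [|a v|] is comparable to
   [circled p v] and the system [lin (A j) z = w j] stays triangular. *)
Lemma frame (n : nat) :
  (forall v, is_vec n v -> v <> vzero -> 0 < circled p v) ->
  forall k, (k <= n)%nat ->
  exists A : nat -> nat -> C,
    (forall j, (j < k)%nat -> forall z, is_vec n z -> fst (lin n (A j) z) <= p z) /\
    (forall z, is_vec k z -> (forall j, (j < k)%nat -> lin n (A j) z = C0) -> z = vzero) /\
    (forall w d, 0 <= d -> (forall j, (j < k)%nat -> Cabs (w j) <= d) ->
      exists z, is_vec k z /\ (forall j, (j < k)%nat -> lin n (A j) z = w j) /\
        circled p z + d <= 17 ^ k * d).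
Proof.
  intros Hnd; induction k as [|k IH]; intros Hk.
  - exists (fun _ _ => C0); split; [intros; lia|split].
    + intros z Hz _; apply functional_extensionality; intros i; apply Hz; lia.
    + intros w d Hd _; exists vzero; split; [intros i _; reflexivity|split; [intros; lia|]].
      assert (circled p vzero = 0) as ->; [|simpl; lra].
      unfold circled; replace (vrscale (-1) vzero) with vzero by vring.
      replace (vcscale (0, 1) vzero) with vzero by vring.
      replace (vcscale (0, -1) vzero) with vzero by vring.
      rewrite (sublinear_zero p Hp); ring.
  - destruct IH as [A [HA [Hinj Hsurj]]]; [lia|].
    assert (exists d, 0 <= d /\ forall j, (j < k)%nat -> Cabs (Copp (lin n (A j) (basis k C1))) <= d)
      as [d [Hd Hdj]]
      by apply (finite_bound (fun j => Cabs (Copp (lin n (A j) (basis k C1))))).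
    (* Solving for the values [- A_j(e_k)] gives a correction [u] in C^k such that [e_k + u] is
       killed by all earlier forms. The size of [u] does not matter here. *)
    destruct (Hsurj _ d Hd Hdj) as [u [Hu [Hul _]]]; clear d Hd Hdj.
    set (v := vadd (basis k C1) u).
    assert (is_vec (S k) v) as Hvk.
    { apply is_vec_add; [apply is_vec_basis|apply (is_vec_le k); [lia|exact Hu]]. }
    assert (v k = C1) as Hv1.
    { unfold v, vadd, basis; rewrite Nat.eqb_refl, Hu by lia; cring. }
    assert (is_vec n v) as Hvn by (apply (is_vec_le (S k)); assumption).
    assert (forall j, (j < k)%nat -> lin n (A j) v = C0) as Hv0.
    { intros j Hj; unfold v; rewrite lin_add, Hul by exact Hj; ring. }
    assert (0 < circled p v) as HNv.
    { apply Hnd; [exact Hvn|]; intros E; rewrite E in Hv1.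
      unfold vzero, C0, C1 in Hv1; injection Hv1; lra. }
    destruct (circled_rotation v) as [c [Hc1 Hc]].
    destruct (support_functional n p (vcscale c v) Hp (is_vec_cscale n c v Hvn)) as [a [Ha Hav]].
    (* [a] supports [p] at [c v] and [|c| = 1], so [|a v| >= p (c v)]. *)
    assert (circled p v <= 4 * Cabs (lin n a v)) as Hbig.
    { rewrite lin_cscale in Hav; pose proof (Rabs_fst_le (Cmul c (lin n a v))) as H.
      rewrite Cabs_mul, Hc1, Hav in H; pose proof (Rle_abs (p (vcscale c v))); lra. }
    assert (lin n a v <> C0) as Hne by (apply Cabs_pos_neq0; lra).
    exists (fun j => if Nat.ltb j k then A j else a); split; [|split].
    + intros j Hj; destruct (Nat.ltb_spec j k); auto.
    + intros z Hz H0.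
      (* Since [v k = 1], the difference [z - z_k v] lies in C^k, and the earlier forms vanish on
         it. *)
      assert (z = vcscale (z k) v) as Hzv.
      { assert (vsub z (vcscale (z k) v) = vzero) as E.
        { apply Hinj.
          - intros i Hi; destruct (Nat.eq_dec i k) as [->|].
            + unfold vsub, vcscale; rewrite Hv1; ring.
            + apply (is_vec_sub (S k)); [exact Hz|apply is_vec_cscale; exact Hvk|lia].
          - intros j Hj; rewrite lin_sub, lin_cscale, Hv0 by exact Hj.
            specialize (H0 j ltac:(lia)); destruct (Nat.ltb_spec j k); [|lia].
            rewrite H0; ring. }
        apply functional_extensionality; intros i; apply (f_equal (fun f => f i)) in E.
        unfold vsub, vzero in E.
        replace (z i) with (Cadd (Csub (z i) (vcscale (z k) v i)) (vcscale (z k) v i)) by ring.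
        rewrite E; ring. }
      assert (z k = C0) as Hzk.
      { specialize (H0 k ltac:(lia)); rewrite Nat.ltb_irrefl, Hzv, lin_cscale in H0.
        replace (z k) with (Cdiv (Cmul (z k) (lin n a v)) (lin n a v)) by (field; exact Hne).
        rewrite H0; field; exact Hne. }
      rewrite Hzv, Hzk; vring.
    + intros w d Hd Hw.
      destruct (Hsurj w d Hd) as [z [Hz [Hzl HNz]]]; [intros; apply Hw; lia|].
      assert (is_vec n z) as Hzn by (apply (is_vec_le k); [lia|exact Hz]).
      set (t := Cdiv (Csub (w k) (lin n a z)) (lin n a v)).
      exists (vadd z (vcscale t v)); split; [|split].
      * apply is_vec_add; [apply (is_vec_le k); [lia|exact Hz]|apply is_vec_cscale; exact Hvk].
      * intros j Hj; rewrite lin_add, lin_cscale; destruct (Nat.ltb_spec j k) as [Hjk|Hjk].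
        { rewrite Hzl, Hv0 by exact Hjk; ring. }
        { replace j with k by lia; unfold t; field; exact Hne. }
      * pose proof (circled_add z (vcscale t v)); pose proof (circled_cscale t v).
        pose proof (Cabs_div (Csub (w k) (lin n a z)) _ Hne) as Ht; fold t in Ht.
        pose proof (Cabs_sub (w k) (lin n a z)).
        pose proof (Hw k ltac:(lia)).
        pose proof (Cabs_lin_le n a z Ha Hzn).
        pose proof (Cabs_pos t).
        (* Another factor 4 from [circled_cscale] bounds [circled p (t v)] by
           [16 (d + circled p z)], whence 17. Carrying the summand [d] makes the recursion purely
           multiplicative. *)
        assert (Cabs t * circled p v <= 4 * (d + circled p z)) by nra.
        simpl; lra.
Qed.

End Frame.

(** * Holomorphy and complex lines *)

Lemma rsum_bounds (n : nat) (f : nat -> R) (c : R) :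
  (forall j, (j < n)%nat -> 0 <= f j <= c) -> 0 <= rsum n f <= INR n * c.
Proof.
  induction n as [|n IH]; intros H; [simpl; lra|].
  rewrite S_INR; simpl; specialize (IH ltac:(intros; apply H; lia)); specialize (H n ltac:(lia)); lra.
Qed.

Lemma rsum_term_le (n : nat) (f : nat -> R) (i : nat) :
  (forall j, 0 <= f j) -> (i < n)%nat -> f i <= rsum n f.
Proof.
  intros Hf; induction n as [|n IH]; intros Hi; [lia|simpl].
  assert (0 <= rsum n f).
  { clear IH Hi; induction n; simpl; [lra|specialize (Hf n); lra]. }
  specialize (Hf n); destruct (Nat.eq_dec i n) as [->|]; [lra|specialize (IH ltac:(lia)); lra].
Qed.

Lemma Cnorm2_nonneg (a : C) : 0 <= Cnorm2 a.
Proof. unfold Cnorm2; nra. Qed.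

Lemma Cabs_le_vnorm (n : nat) (v : Cvec) (i : nat) : (i < n)%nat -> Cabs (v i) <= vnorm n v.
Proof.
  intros Hi; apply sqrt_le_1_alt.
  apply (rsum_term_le n (fun i => Cnorm2 (v i))); [intros; apply Cnorm2_nonneg|exact Hi].
Qed.

Lemma vnorm_le (n : nat) (v : Cvec) (c : R) :
  0 <= c -> (forall i, (i < n)%nat -> Cabs (v i) <= c) -> vnorm n v <= INR n * c.
Proof.
  intros Hc H.
  destruct (rsum_bounds n (fun i => Cnorm2 (v i)) (c * c)) as [_ H1].
  { intros j Hj; split; [apply Cnorm2_nonneg|]; rewrite <- Cabs_sqr.
    specialize (H j Hj); pose proof (Cabs_pos (v j)); nra. }
  pose proof (pos_INR n).
  (* Trades the sharp factor [sqrt n] for [n]. *)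
  assert (INR n <= INR n * INR n) as Hn.
  { destruct n; [simpl; lra|]; pose proof (le_INR 1 (S n) ltac:(lia)) as H2; simpl (INR 1) in H2; nra. }
  unfold vnorm; rewrite <- (sqrt_square (INR n * c)) by nra.
  apply sqrt_le_1_alt; nra.
Qed.

Lemma Cabs_lin_le_vnorm (n : nat) (a : nat -> C) :
  exists M, 0 <= M /\ forall v, Cabs (lin n a v) <= M * vnorm n v.
Proof.
  destruct (finite_bound (fun j => Cabs (a j)) n) as [d [Hd Hj]].
  exists (INR n * d); split; [pose proof (pos_INR n); nra|]; intros v.
  assert (forall k, (k <= n)%nat -> Cabs (lin k a v) <= INR k * (d * vnorm n v)) as H.
  { induction k as [|k IH]; intros Hk; [unfold lin; simpl; rewrite Cabs_C0; lra|].
    rewrite S_INR; unfold lin; simpl; eapply Rle_trans; [apply Cabs_add|].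
    specialize (IH ltac:(lia)); unfold lin in IH; rewrite Cabs_mul.
    specialize (Hj k Hk); simpl in Hj; pose proof (Cabs_le_vnorm n v k Hk).
    pose proof (Cabs_pos (a k)); pose proof (Cabs_pos (v k)); nra. }
  rewrite Rmult_assoc; apply H; lia.
Qed.

Lemma holomorphic_of_quadratic (n m : nat) (U : cset) (f : Cvec -> Cvec) :
  (forall z, U z -> is_vec m (f z)) ->
  (forall z, U z -> exists A K, 0 <= K /\ forall w, U w -> forall i, (i < m)%nat ->
    Cabs (vsub (vsub (f w) (f z)) (cmatvec n A (vsub w z)) i)
      <= K * (vnorm n (vsub w z) * vnorm n (vsub w z))) ->
  holomorphic n m U f.
Proof.
  intros Hv H; split; [exact Hv|]; intros z Hz; destruct (H z Hz) as [A [K [HK HA]]].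
  exists A; intros eps Heps; pose proof (pos_INR m).
  assert (0 <= INR m * K) by nra.
  (* The error is at most [m K x^2] for [x] the norm of [w - z]; the 1 avoids a zero denominator. *)
  exists (eps / (INR m * K + 1)); split; [apply Rdiv_lt_0_compat; lra|].
  intros w Hw Hd; set (x := vnorm n (vsub w z)) in *.
  assert (0 <= x) by apply sqrt_pos.
  apply (Rmult_lt_compat_r (INR m * K + 1)) in Hd; [|lra].
  unfold Rdiv in Hd; rewrite Rmult_assoc, Rinv_l, Rmult_1_r in Hd by lra.
  eapply Rle_trans; [apply vnorm_le; [|apply HA; exact Hw]; fold x; apply Rmult_le_pos; [exact HK|nra]|].
  fold x; assert (INR m * K * x <= eps) by nra; nra.
Qed.

(** For any [t] in (0,1) the disc [z -> x + (z / t) v] joins [x] to [x + v] by a chain of one link,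
    whose length tends to 0 with [t]. A nonzero [v] would thus contradict hyperbolicity. *)
Lemma hyperbolic_no_complex_line (n : nat) (Om : cset) (x v : Cvec) :
  subset_Cn n Om -> kobayashi_hyperbolic n Om -> is_vec n v ->
  (forall c, Om (vadd x (vcscale c v))) -> v = vzero.
Proof.
  intros Hsub Hk Hv Hline; apply NNPP; intros Hne.
  destruct (Hk (vadd x (vcscale C0 v)) (vadd x (vcscale C1 v)) (Hline _) (Hline _)) as [c [Hc Hge]].
  { intros E; apply Hne; apply functional_extensionality; intros i.
    apply (f_equal (fun f => f i)) in E; unfold vadd, vcscale in E; unfold vzero.
    replace (v i) with (Csub (Cadd (x i) (Cmul C1 (v i))) (Cadd (x i) (Cmul C0 (v i)))) by ring.
    rewrite <- E; ring. }
  (* chosen so that the Poincare distance from 0 to [t] is [c / 2] *)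
  set (t := (exp c - 1) / (exp c + 1)).
  pose proof (exp_ineq1 c ltac:(lra)) as He.
  assert (t * (exp c + 1) = exp c - 1) as Et by (unfold t; field; lra).
  assert (0 < t) as Ht0 by (apply Rdiv_lt_0_compat; lra).
  assert (t < 1) as Ht1 by nra.
  assert (Cabs (t, 0) = t) as Habs.
  { unfold Cabs, Cnorm2; simpl; replace (t * t + 0 * 0) with (t * t) by ring; apply sqrt_square; lra. }
  specialize (Hge 1%nat (fun _ z => vadd x (vcscale (Cmul (z O) (/ t, 0)) v))
                (fun _ => vzero) (fun _ => basis 0 (t, 0))).
  assert (forall r, vnorm 1 (vsub (basis 0 r) vzero) = Cabs r) as Hnorm.
  { intros r; unfold vnorm, Cabs; f_equal; unfold vsub, vzero, basis, Cnorm2; simpl; ring. }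
  assert (c <= kob_chain_length 1 (fun _ => vzero) (fun _ => basis 0 (t, 0))) as Hle.
  { apply Hge; split; [lia|split; [|split; [|split; [intros; lia|]]]].
    - intros j _; split; [|split; [intros; apply Hline|split; split]].
      + apply holomorphic_of_quadratic; [intros; apply Hsub, Hline|].
        intros z _; exists (fun i _ => Cmul (/ t, 0) (v i)), 0; split; [lra|]; intros w _ i _.
        match goal with |- Cabs ?e <= _ => replace e with C0 end; [rewrite Cabs_C0; lra|].
        apply C_ext; simpl; ring.
      + intros i _; reflexivity.
      + replace vzero with (basis 0 C0) at 1; [rewrite Hnorm, Cabs_C0; lra|].
        apply functional_extensionality; intros i; unfold basis; destruct (Nat.eqb i 0); reflexivity.
      + apply is_vec_basis.
      + rewrite Hnorm, Habs; exact Ht1.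
    - apply functional_extensionality; intros i; unfold vadd, vcscale, vzero; ring.
    - simpl; unfold basis; simpl; apply functional_extensionality; intros i.
      apply C_ext; simpl; field; lra. }
  unfold kob_chain_length in Hle; simpl in Hle; unfold poincare, vzero, basis in Hle; simpl in Hle.
  replace (Csub C0 (t, 0)) with (Copp (t, 0)) in Hle by cring.
  rewrite Cabs_opp, Habs in Hle.
  replace (Csub C1 (Cmul (Cconj C0) (t, 0))) with C1 in Hle by cring.
  change (Cabs C1) with (Cabs (1, 0)) in Hle; rewrite Cabs_unit in Hle by ring.
  replace ((1 + t / 1) / (1 - t / 1)) with (exp c) in Hle by (field_simplify_eq; lra).
  rewrite ln_exp in Hle; lra.
Qed.

(** * Cayley transforms *)

Definition C4 : C := (4, 0).

Lemma Cabs_C4 : Cabs C4 = 4.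
Proof.
  unfold Cabs, Cnorm2; simpl; replace (4 * 4 + 0 * 0) with (4 * 4) by ring; apply sqrt_square; lra.
Qed.

Lemma C4_neq0 : C4 <> C0.
Proof. unfold C4, C0; intros E; injection E; lra. Qed.

(* The biholomorphism from the half plane [Re w < 2] onto the disc fixing 0. *)
Definition cayley (w : C) : C := Cdiv w (Csub C4 w).

(** The bound [Re w <= 1] is what the gauge provides on the translated domain; it keeps [w] at
    distance at least 3 from the pole 4. *)
Lemma cayley_den (w : C) : fst w <= 1 -> 3 <= Cabs (Csub C4 w).
Proof.
  intros H; pose proof (Rabs_fst_le (Csub C4 w)) as H1.
  pose proof (Rle_abs (fst (Csub C4 w))); simpl in *; lra.
Qed.

Lemma cayley_den_neq0 (w : C) : fst w <= 1 -> Csub C4 w <> C0.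
Proof. intros H; pose proof (cayley_den w H); apply Cabs_pos_neq0; lra. Qed.

(** [|4 - w|^2 - |w|^2 = 16 - 8 Re w > 0]. *)
Lemma cayley_lt1 (w : C) : fst w <= 1 -> Cabs (cayley w) < 1.
Proof.
  intros H; pose proof (cayley_den w H).
  pose proof (Cabs_div w _ (cayley_den_neq0 w H)) as E; fold (cayley w) in E.
  pose proof (Cabs_sqr w) as E1; pose proof (Cabs_sqr (Csub C4 w)) as E2.
  pose proof (Cabs_pos w); pose proof (Cabs_pos (cayley w)).
  unfold Cnorm2 in E1, E2; simpl in E1, E2.
  assert (Cabs w < Cabs (Csub C4 w)) by nra; nra.
Qed.

Definition cayley_inv (u : C) : C := Cdiv (Cmul C4 u) (Cadd C1 u).

Lemma cayleyK (w : C) : fst w <= 1 -> cayley_inv (cayley w) = w.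
Proof.
  intros Hw; pose proof (cayley_den_neq0 w Hw) as Hd.
  unfold cayley_inv, cayley; replace (Cadd C1 (Cdiv w (Csub C4 w))) with (Cdiv C4 (Csub C4 w)).
  - field; split; [exact Hd|apply C4_neq0].
  - replace (Cadd C1 (Cdiv w (Csub C4 w)))
      with (Cdiv (Cadd (Csub C4 w) w) (Csub C4 w)) by (field; exact Hd).
    f_equal; ring.
Qed.

Lemma Cabs_add1_ge (u : C) : Cabs u <= / 2 -> / 2 <= Cabs (Cadd C1 u).
Proof.
  intros Hu; pose proof (Rabs_fst_le (Cadd C1 u)) as H; pose proof (Rle_abs (fst (Cadd C1 u))).
  pose proof (Rabs_fst_le u); pose proof (Rle_abs (- fst u)) as H2; rewrite Rabs_Ropp in H2.
  simpl in *; lra.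
Qed.

Lemma cayley_invK (u : C) : Cabs u <= / 2 -> cayley (cayley_inv u) = u.
Proof.
  intros Hu; pose proof (Cabs_add1_ge u Hu).
  assert (Cadd C1 u <> C0) as Hne by (apply Cabs_pos_neq0; lra).
  unfold cayley, cayley_inv.
  replace (Csub C4 (Cdiv (Cmul C4 u) (Cadd C1 u))) with (Cdiv C4 (Cadd C1 u)) by (field; exact Hne).
  field; split; [exact Hne|apply C4_neq0].
Qed.

(** The radius [/ 2] keeps the denominator [1 + u] at least [/ 2] in modulus, and
    [4 / (1/2) = 8]. *)
Lemma Cabs_cayley_inv_le (u : C) : Cabs u <= / 2 -> Cabs (cayley_inv u) <= 8 * Cabs u.
Proof.
  intros Hu; pose proof (Cabs_add1_ge u Hu).
  assert (Cadd C1 u <> C0) as Hne by (apply Cabs_pos_neq0; lra).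
  pose proof (Cabs_div (Cmul C4 u) _ Hne) as E; fold (cayley_inv u) in E.
  rewrite Cabs_mul, Cabs_C4 in E; pose proof (Cabs_pos (cayley_inv u)); nra.
Qed.

Definition cayley_deriv (w : C) : C := Cdiv C4 (Cmul (Csub C4 w) (Csub C4 w)).

(** The remainder is exactly [4 (w - w0)^2 / ((4 - w) (4 - w0)^2)], and each factor of the
    denominator has modulus at least 3. *)
Lemma cayley_quadratic (w w0 : C) :
  fst w <= 1 -> fst w0 <= 1 ->
  Cabs (Csub (Csub (cayley w) (cayley w0)) (Cmul (cayley_deriv w0) (Csub w w0)))
    <= Cabs (Csub w w0) * Cabs (Csub w w0).
Proof.
  intros H H0; set (r := Csub (Csub (cayley w) (cayley w0)) _).
  pose proof (cayley_den_neq0 w H) as Hn; pose proof (cayley_den_neq0 w0 H0) as Hn0.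
  assert (Cmul r (Cmul (Csub C4 w) (Cmul (Csub C4 w0) (Csub C4 w0)))
          = Cmul C4 (Cmul (Csub w w0) (Csub w w0))) as E.
  { replace r with (Cdiv (Cmul C4 (Cmul (Csub w w0) (Csub w w0)))
      (Cmul (Csub C4 w) (Cmul (Csub C4 w0) (Csub C4 w0)))).
    - field; split; assumption.
    - unfold r, cayley, cayley_deriv.
      field; split; assumption. }
  apply (f_equal Cabs) in E; rewrite !Cabs_mul in E.
  rewrite Cabs_C4 in E.
  pose proof (cayley_den w H) as D; pose proof (cayley_den w0 H0) as D0.
  pose proof (Cabs_pos r); pose proof (Cabs_pos (Csub w w0)).
  set (a := Cabs (Csub C4 w)) in *; set (b := Cabs (Csub C4 w0)) in *.
  assert (9 <= b * b) by nra; assert (4 <= a * (b * b)) by nra; nra.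
Qed.

(** * The squeezing map at a point of the domain *)

Lemma lin_coef_scale (n : nat) (c : C) (a : nat -> C) (v : Cvec) :
  csum n (fun j => Cmul (Cmul c (a j)) (v j)) = Cmul c (lin n a v).
Proof. unfold lin; induction n as [|n IH]; simpl; [ring|rewrite IH; ring]. Qed.

Lemma translated_gauge (n : nat) (Om : cset) (x : Cvec) :
  open_Cn n Om -> convex_Cn n Om -> Om x ->
  exists p, sublinear p /\ (forall v, 0 <= p v) /\
    (forall v, is_vec n v -> p v < 1 -> Om (vadd x v)) /\ (forall z, Om z -> p (vsub z x) <= 1).
Proof.
  intros [Hsub Hopen] Hc Hx.
  (* [gauge] asks for a set that absorbs every sequence, so coordinates from [n] on are ignored by
     truncation. *)
  destruct (gauge n (fun v => Om (vadd x (trunc n v)))) as [p [Hp [Hpos [Hlt Hle]]]].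
  - intros u v t Hu Hv Ht.
    replace (vadd x (trunc n (vadd (vrscale (1 - t) u) (vrscale t v))))
      with (vadd (vrscale (1 - t) (vadd x (trunc n u))) (vrscale t (vadd x (trunc n v)))).
    + apply Hc; assumption.
    + apply functional_extensionality; intros i; unfold vadd, vrscale, trunc.
      destruct (Nat.ltb i n); cring.
  - intros v; destruct (Hopen x Hx) as [e [He Hball]].
    destruct (finite_bound (fun j => Cabs (v j)) n) as [d [Hd Hj]].
    assert (0 <= INR n * d) by (apply Rmult_le_pos; [apply pos_INR|exact Hd]).
    (* Divided by this factor, [v] has norm at most [n d e / (n d + 1) < e]; the 1 covers
       [d = 0]. *)
    assert (0 < (INR n * d + 1) / e) as Ht by (apply Rdiv_lt_0_compat; lra).
    exists ((INR n * d + 1) / e); split; [exact Ht|].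
    set (s := / ((INR n * d + 1) / e)).
    assert (0 < s) as Hs by (apply Rinv_0_lt_compat; exact Ht).
    assert (s * (INR n * d + 1) = e) as Es by (unfold s; field; split; lra).
    apply Hball; split.
    + apply is_vec_add; [apply Hsub, Hx|apply trunc_is_vec].
    + apply Rle_lt_trans with (INR n * (s * d)); [|nra].
      apply vnorm_le; [nra|]; intros i Hi.
      assert (vsub (vadd x (trunc n (vrscale s v))) x i = Cmul (s, 0) (v i)) as ->.
      { unfold vsub, vadd, trunc, vrscale; destruct (Nat.ltb_spec i n); [cring|lia]. }
      rewrite Cabs_mul; specialize (Hj i Hi); simpl in Hj.
      assert (Cabs (s, 0) <= s).
      { eapply Rle_trans; [apply Cabs_le_sum|]; simpl; rewrite Rabs_R0, Rabs_pos_eq; lra. }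
      pose proof (Cabs_pos (v i)); nra.
  - exists p; split; [exact Hp|split; [exact Hpos|split]].
    + intros v Hv H; rewrite <- (trunc_id n v Hv); apply Hlt, H.
    + intros z Hz; apply Hle.
      rewrite trunc_id by (apply is_vec_sub; apply Hsub; assumption).
      replace (vadd x (vsub z x)) with z by vring; exact Hz.
Qed.

(** The factor [/ n] shrinks the unit polydisc into the unit ball. *)
Definition squeeze (n : nat) (A : nat -> nat -> C) (x : Cvec) (z : Cvec) : Cvec :=
  fun i => if Nat.ltb i n then Cmul (/ INR n, 0) (cayley (lin n (A i) (vsub z x))) else C0.

Lemma Cabs_inv_INR (n : nat) : (1 <= n)%nat -> Cabs (/ INR n, 0) = / INR n.
Proof.
  intros Hn; pose proof (lt_0_INR n ltac:(lia)) as H; apply Rinv_0_lt_compat in H.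
  unfold Cabs, Cnorm2; simpl.
  replace (/ INR n * / INR n + 0 * 0) with (/ INR n * / INR n) by ring; apply sqrt_square; lra.
Qed.

Lemma Cabs_lin_family_le_vnorm (n : nat) (A : nat -> nat -> C) (k : nat) :
  exists M, 0 <= M /\ forall i, (i < k)%nat -> forall v, Cabs (lin n (A i) v) <= M * vnorm n v.
Proof.
  induction k as [|k [M [HM H]]].
  - exists 0; split; [lra|intros; lia].
  - destruct (Cabs_lin_le_vnorm n (A k)) as [M' [HM' H']].
    exists (M + M'); split; [lra|]; intros i Hi v.
    assert (0 <= vnorm n v) by apply sqrt_pos.
    destruct (Nat.eq_dec i k) as [->|]; [specialize (H' v)|specialize (H i ltac:(lia) v)]; nra.
Qed.

(** The quadratic error of [cayley] composed with forms bounded by [M] gives the constant [M^2]. *)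
Lemma squeeze_holomorphic (n : nat) (Om : cset) (A : nat -> nat -> C) (x : Cvec) :
  (1 <= n)%nat ->
  (forall i, (i < n)%nat -> forall z, Om z -> fst (lin n (A i) (vsub z x)) <= 1) ->
  holomorphic n n Om (squeeze n A x).
Proof.
  intros Hn HA; apply holomorphic_of_quadratic.
  - intros z _ i Hi; unfold squeeze; destruct (Nat.ltb_spec i n); [lia|reflexivity].
  - intros z Hz.
    exists (fun i j => Cmul (Cmul (/ INR n, 0) (cayley_deriv (lin n (A i) (vsub z x)))) (A i j)).
    destruct (Cabs_lin_family_le_vnorm n A n) as [M [HM HMv]].
    exists (M * M); split; [nra|]; intros w Hw i Hi.
    unfold cmatvec; unfold vsub at 1 2; rewrite lin_coef_scale; unfold squeeze; destruct (Nat.ltb_spec i n); [|lia].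
    pose proof (cayley_quadratic _ _ (HA i Hi w Hw) (HA i Hi z Hz)) as Hq.
    rewrite <- lin_sub in Hq.
    replace (vsub (vsub w x) (vsub z x)) with (vsub w z) in Hq by vring.
    match type of Hq with Cabs ?r <= _ => set (e := r) in * end.
    match goal with |- Cabs ?r <= _ => replace r with (Cmul (/ INR n, 0) e) by (unfold e; ring) end.
    rewrite Cabs_mul, Cabs_inv_INR by exact Hn.
    assert (/ INR n <= 1) as Hi1.
    { rewrite <- Rinv_1; apply Rinv_le_contravar; [lra|]; apply (le_INR 1 n), Hn. }
    pose proof (Rinv_0_lt_compat _ (lt_0_INR n ltac:(lia))).
    pose proof (HMv i Hi (vsub w z)) as HL.
    pose proof (Cabs_pos e); pose proof (Cabs_pos (lin n (A i) (vsub w z))).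
    assert (0 <= vnorm n (vsub w z)) by apply sqrt_pos.
    assert (Cabs e <= (M * vnorm n (vsub w z)) * (M * vnorm n (vsub w z))) by nra.
    nra.
Qed.

Lemma squeeze_ball (n : nat) (A : nat -> nat -> C) (x z : Cvec) :
  (1 <= n)%nat -> (forall i, (i < n)%nat -> fst (lin n (A i) (vsub z x)) <= 1) ->
  ball n vzero 1 (squeeze n A x z).
Proof.
  intros Hn HA; split.
  - intros i Hi; unfold squeeze; destruct (Nat.ltb_spec i n); [lia|reflexivity].
  - unfold vnorm; rewrite <- sqrt_1; apply sqrt_lt_1_alt.
    pose proof (lt_0_INR n ltac:(lia)) as Hn0.
    set (F := fun i => Cnorm2 (vsub (squeeze n A x z) vzero i)).
    assert (forall i, (i < n)%nat -> 0 <= F i < / INR n * / INR n) as HF.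
    { intros i Hi; split; [apply Cnorm2_nonneg|]; unfold F.
      replace (vsub (squeeze n A x z) vzero i)
        with (Cmul (/ INR n, 0) (cayley (lin n (A i) (vsub z x)))).
      - rewrite <- Cabs_sqr, Cabs_mul, Cabs_inv_INR by exact Hn.
        pose proof (cayley_lt1 _ (HA i Hi)); pose proof (Cabs_pos (cayley (lin n (A i) (vsub z x)))).
        pose proof (Rinv_0_lt_compat _ Hn0).
        set (s := / INR n) in *; set (a := Cabs (cayley _)) in *.
        assert (s * a < s) by nra; assert (0 <= s * a) by nra; nra.
      - unfold squeeze; unfold vsub at 2; destruct (Nat.ltb_spec i n); [cring|lia]. }
    assert (/ INR n <= 1) as Hi1.
    { rewrite <- Rinv_1; apply Rinv_le_contravar; [lra|]; apply (le_INR 1 n), Hn. }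
    assert (INR n * (/ INR n * / INR n) = / INR n) as E by (field; lra).
    (* [rsum_bounds] is not strict, so the last term is split off to supply strictness; the total is
       below [n / n^2 <= 1]. *)
    destruct n as [|m]; [lia|].
    destruct (rsum_bounds m F (/ INR (S m) * / INR (S m))) as [H1 H2].
    { intros j Hj; specialize (HF j ltac:(lia)); lra. }
    specialize (HF m ltac:(lia)); rewrite (S_INR m) in E at 1.
    split; simpl rsum; lra.
Qed.

Lemma squeeze_injective (n : nat) (Om : cset) (A : nat -> nat -> C) (x z w : Cvec) :
  (1 <= n)%nat -> is_vec n z -> is_vec n w ->
  (forall i, (i < n)%nat -> fst (lin n (A i) (vsub z x)) <= 1) ->
  (forall i, (i < n)%nat -> fst (lin n (A i) (vsub w x)) <= 1) ->
  (forall v, is_vec n v -> (forall i, (i < n)%nat -> lin n (A i) v = C0) -> v = vzero) ->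
  squeeze n A x z = squeeze n A x w -> z = w.
Proof.
  intros Hn Hz Hw HAz HAw Hinj E.
  assert (vsub z w = vzero) as E0.
  { apply Hinj; [apply is_vec_sub; assumption|]; intros i Hi.
    replace (vsub z w) with (vsub (vsub z x) (vsub w x)) by vring; rewrite lin_sub.
    apply (f_equal (fun f => f i)) in E; unfold squeeze in E.
    destruct (Nat.ltb_spec i n); [|lia].
    apply (f_equal (Cmul (INR n, 0))) in E.
    assert (forall c, Cmul (INR n, 0) (Cmul (/ INR n, 0) c) = c) as Hc.
    { pose proof (lt_0_INR n ltac:(lia)); intros c; apply C_ext; simpl; field; lra. }
    rewrite !Hc in E; apply (f_equal cayley_inv) in E; rewrite !cayleyK in E by auto.
    rewrite E; ring. }
  replace z with (vadd w (vsub z w)) by vring; rewrite E0; vring.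
Qed.

Theorem theorem2p1 (n : nat) (Omega : cset) :
  (1 <= n)%nat ->
  subset_Cn n Omega ->
  domain_Cn n Omega ->
  convex_Cn n Omega ->
  kobayashi_hyperbolic n Omega ->
  HHR n Omega.
Proof.
  intros Hn Hsub [Hopen _] Hconv Hhyp.
  pose proof (lt_0_INR n ltac:(lia)) as Hn0.
  pose proof (pow_R1_Rle 17 n ltac:(lra)) as H17.
  (* 8 is the loss of [cayley_inv], [n] undoes the division in [squeeze], and [17 ^ n] is the loss
     of [frame]. *)
  exists (/ (8 * INR n * 17 ^ n)); split; [apply Rinv_0_lt_compat; nra|].
  intros x Hx r [Hr0 Hr].
  destruct (translated_gauge n Omega x Hopen Hconv Hx) as [p [Hp [Hpos [Hlt Hle]]]].
  destruct (frame p Hp Hpos n) with (k := n) as [A [HA [Hinj Hsurj]]]; [|lia|].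
  (* If [circled p v = 0], then [p (c v) = 0 < 1] for every complex [c], and the whole line
     [x + C v] lies in [Omega]. *)
  { intros v Hv Hne; destruct (circled_pos p Hpos v) as [|H0]; [assumption|exfalso; apply Hne].
    apply (hyperbolic_no_complex_line n Omega x v Hsub Hhyp Hv); intros c.
    apply Hlt; [apply is_vec_cscale, Hv|].
    pose proof (gauge_cscale p Hp Hpos c v); nra. }
  assert (forall i, (i < n)%nat -> forall z, Omega z -> fst (lin n (A i) (vsub z x)) <= 1) as HA1.
  { intros i Hi z Hz; eapply Rle_trans; [apply HA; [exact Hi|]|apply Hle, Hz].
    apply is_vec_sub; apply Hsub; assumption. }
  exists (squeeze n A x); split; [split; [|split; [|split]]|].
  - apply squeeze_holomorphic; assumption.
  - intros z Hz; apply squeeze_ball; auto.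
  - intros z w Hz Hw; apply squeeze_injective; auto.
  - apply functional_extensionality; intros i; unfold squeeze.
    destruct (Nat.ltb i n); [|reflexivity].
    replace (vsub x x) with (vcscale C0 vzero) by vring; rewrite lin_cscale.
    unfold cayley, Cdiv, vzero; ring.
  - intros w [Hw Hwr].
    assert (forall i, (i < n)%nat -> Cabs (w i) <= r) as Hwi.
    { intros i Hi; pose proof (Cabs_le_vnorm n (vsub w vzero) i Hi).
      replace (vsub w vzero) with w in * by vring; lra. }
    assert (8 * INR n * r * 17 ^ n < 1) as Hc.
    { apply (Rmult_lt_compat_r (8 * INR n * 17 ^ n)) in Hr; [|nra].
      rewrite Rinv_l in Hr by nra; lra. }
    assert (forall i, (i < n)%nat -> Cabs (Cmul (INR n, 0) (w i)) <= INR n * r) as Hu.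
    { intros i Hi; rewrite Cabs_mul; specialize (Hwi i Hi); pose proof (Cabs_pos (w i)).
      assert (Cabs (INR n, 0) <= INR n); [|nra].
      eapply Rle_trans; [apply Cabs_le_sum|]; simpl; rewrite Rabs_R0, Rabs_pos_eq; lra. }
    assert (0 < INR n * r) by nra.
    assert (INR n * r <= / 2) by nra.
    (* The preimage of [w] is [x + v] with [l_i(v) = cayley_inv (n w_i)]. These values are at most
       [8 n r], so [p v <= circled p v < 17^n 8 n r < 1] puts [x + v] in [Omega]. *)
    destruct (Hsurj (fun i => cayley_inv (Cmul (INR n, 0) (w i))) (8 * (INR n * r)))
      as [v [Hv [Hvl HNv]]]; [lra| |].
    { intros i Hi; specialize (Hu i Hi).
      eapply Rle_trans; [apply Cabs_cayley_inv_le|]; lra. }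
    exists (vadd x v); split.
    + apply Hlt; [exact Hv|]; pose proof (circled_ge p Hpos v); lra.
    + apply functional_extensionality; intros i; unfold squeeze.
      destruct (Nat.ltb_spec i n) as [Hi|Hi]; [|symmetry; apply Hw, Hi].
      replace (vsub (vadd x v) x) with v by vring.
      specialize (Hu i Hi); rewrite Hvl, cayley_invK by (assumption || lra).
      apply C_ext; simpl; field; lra.
Qed.
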